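(* Let $S$ be an embeddable monoid, $\alpha$ a continuous action $S\curvearrowright X$ on a topological space $X$, and $\mathbf{G}=(G,\eta)$ a receiving group for $S$. The following are equivalent. (i) The map $\pi\colon X_{\mathbf{G}}\to X$ is surjective, and in particular $X_{\mathbf{G}}\neq\varnothing$. (ii) The natural $\mathbf{G}$-extension of $\alpha$ exists. (iii) There exists a $\mathbf{G}$-extension of $\alpha$. When these conditions hold, the natural $\mathbf{G}$-extension of $\alpha$ is isomorphic (as a $\mathbf{G}$-extension) to $(X_{\mathbf{G}},\sigma,\pi)$.
   Context: All semigroups (in particular all monoids and groups) are countable and discrete. A continuous action of a monoid $S$ on a topological space $X$ is a map $(s,x)\mapsto s\cdot x$ with $1_S\cdot x=x$, $s\cdot(t\cdot x)=(st)\cdot x$, and each map $x\mapsto s\cdot x$ continuous. $S$ is embeddable if there is an injective semigroup morphism from $S$ into a group. A receiving group for $S$ is a pair $\mathbf{G}=(G,\eta)$ with $G$ a group and $\eta\colon S\to G$ an injective semigroup morphism. A $\mathbf{G}$-extension of $\alpha$ is a tuple $(\hat X,\beta,\tau)$ where $\beta$ is a continuous action $G\curvearrowright\hat X$ on a topological space and $\tau\colon\hat X\to X$ is a continuous surjection with $s\cdot\tau(\hat x)=\tau(\eta(s)\cdot\hat x)$ for all $s\in S$, $\hat x\in\hat X$. A morphism of $\mathbf{G}$-extensions $(\hat X',\beta',\tau')\to(\hat X,\beta,\tau)$ is a continuous $G$-equivariant map $\varphi\colon\hat X'\to\hat X$ with $\tau\circ\varphi=\tau'$. A $\mathbf{G}$-extension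 $(\hat X,\beta,\tau)$ is natural if from every other $\mathbf{G}$-extension of $\alpha$ there is a unique morphism of $\mathbf{G}$-extensions to it. $X_{\mathbf{G}}=\{(x_h)_{h\in G}\in X^G: s\cdot x_h=x_{\eta(s)h}\text{ for all }s\in S,h\in G\}$ with the subspace topology of the product topology; $\sigma$ is the restriction to $X_{\mathbf{G}}$ of the shift action $(g\cdot\overline x)_h=x_{hg}$ of $G$ on $X^G$; $\pi((x_h)_{h\in G})=x_{1_G}$. *)

(* Defs.v *)
From mathcomp Require Import all_boot all_classical.
From mathcomp Require Import reals topology function_spaces.
Set Implicit Arguments.
Unset Strict Implicit.
Unset Printing Implicit Defensive.

Local Open Scope classical_set_scope.
Local Open Scope group_scope.

Record continuous_action (S : monoidType) (X : topologicalType) :=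
  ContinuousAction {
    action_fun :> S -> X -> X;
    action1 : forall x, action_fun 1 x = x;
    actionM : forall s t x, action_fun s (action_fun t x) = action_fun (s * t) x;
    action_continuous : forall s, continuous (action_fun s)
  }.

(* Only multiplication is required to be preserved (semigroup morphism); when
   the target is a group, preservation of 1 follows. All groups are countable
   by convention. *)
Definition embeddable (S : monoidType) : Prop :=
  exists G : groupType, countable [set: G] /\
  exists eta : {multiplicative S -> G}, injective eta.

Record receiving_group (S : monoidType) := ReceivingGroup {
  receiving_sort :> groupType;
  receiving_countable : countable [set: receiving_sort];
  receiving_map : {multiplicative S -> receiving_sort};
  receiving_inj : injective receiving_map
}.

Section Extensions.
Context (S : monoidType) (X : topologicalType) (alpha : continuous_action S X).
Context (G : receiving_group S).
Local Notation eta := (receiving_map G).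

Record extension := Extension {
  ext_space : topologicalType;
  ext_action : continuous_action G ext_space;
  ext_map : ext_space -> X;
  ext_continuous : continuous ext_map;
  ext_surj : set_surj [set: ext_space] [set: X] ext_map;
  ext_equivariant : forall s x,
    alpha s (ext_map x) = ext_map (ext_action (eta s) x)
}.

Definition ext_morphism (E' E : extension)
    (phi : ext_space E' -> ext_space E) : Prop :=
  [/\ continuous phi,
      forall g x, phi (ext_action E' g x) = ext_action E g (phi x) &
      ext_map (e := E) \o phi = ext_map (e := E')].

Definition ext_isomorphic (E' E : extension) : Prop :=
  exists (phi : ext_space E' -> ext_space E)
         (psi : ext_space E -> ext_space E'),
    [/\ ext_morphism phi, ext_morphism psi, cancel phi psi & cancel psi phi].

Definition natural (E : extension) : Prop :=
  forall E' : extension,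
    exists! phi : ext_space E' -> ext_space E, ext_morphism phi.

(* [{ptws G -> X}] carries the product topology, and the type [XG] coerced from
   the set [XG_set] carries the topology induced from it. *)
Definition XG_set : set {ptws G -> X} :=
  [set x | forall (s : S) (h : G), alpha s (x h) = x (eta s * h)].

Definition XG : topologicalType := XG_set.

Definition shift (g : G) (x : {ptws G -> X}) : {ptws G -> X} :=
  fun h => x (h * g).

Lemma shift_XG g (x : XG) : XG_set (shift g (\val x)).
Proof. by move=> s h; rewrite /shift (set_valP x) mulgA. Qed.

Definition XG_shift_fun (g : G) (x : XG) : XG := SigSub (mem_set (shift_XG g x)).

Definition XG_proj (x : XG) : X := \val x 1.

Lemma XG_shift1 x : XG_shift_fun 1 x = x.
Proof. by apply/val_inj/funext => h; rewrite /= /shift mulg1. Qed.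

Lemma XG_shiftM g k x : XG_shift_fun g (XG_shift_fun k x) = XG_shift_fun (g * k) x.
Proof. by apply/val_inj/funext => h; rewrite /= /shift mulgA. Qed.

Lemma XG_eval_continuous h : continuous (fun x : XG => \val x h).
Proof.
move=> x; apply: (@continuous_comp XG {ptws G -> X} X set_val (@proj G _ h)).
  exact: initial_continuous.
exact: proj_continuous.
Qed.

Lemma XG_shift_continuous g : continuous (XG_shift_fun g).
Proof.
apply: (@continuous_comp_initial _ XG _ (@set_val _ XG_set)).
move=> x; apply/cvg_sup; first exact/fmap_filter/nbhs_filter.
move=> h U [_ [[W oW <-] /= Wx]] /filterS; apply; first exact/fmap_filter/nbhs_filter.
by apply: (@XG_eval_continuous (h * g) x W); exact: open_nbhs_nbhs.
Qed.

Definition XG_shift : continuous_action G XG :=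
  ContinuousAction XG_shift1 XG_shiftM XG_shift_continuous.

Lemma XG_proj_equivariant s x : alpha s (XG_proj x) = XG_proj (XG_shift (eta s) x).
Proof. by rewrite /XG_proj (set_valP x) /= /shift mulg1 mul1g. Qed.

Definition XG_extension (proj_surj : set_surj [set: XG] [set: X] XG_proj) : extension :=
  Extension (@XG_eval_continuous 1) proj_surj XG_proj_equivariant.

End Extensions.

Arguments XG_set {S X} alpha G.
Arguments XG {S X} alpha G.
Arguments XG_proj {S X} alpha G x.

(* Main.v *)
(** For an extension (E, tau), equivariance forces any morphism to X_G to be
    x |-> (tau (h . x))_h, and this formula always defines one. Hence
    pi \o phi = tau makes pi surjective as soon as some extension exists, and
    (X_G, sigma, pi) is then terminal among extensions, so natural extensions
    are isomorphic to it. *)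
Require Import Defs.
From mathcomp Require Import all_boot all_classical.
From mathcomp Require Import reals topology function_spaces.
Local Open Scope classical_set_scope.

Section NaturalExtension.
Context (S : monoidType) (X : topologicalType) (alpha : continuous_action S X).
Context (G : receiving_group S).
Implicit Types E : extension alpha G.

Definition orbit_map E (x : ext_space E) : {ptws G -> X} :=
  fun h => ext_map (ext_action E h x).

(** Equivariance of tau at the point [h . x] is exactly the condition relating coordinates [h] and
    [eta s * h]. *)
Lemma orbit_map_XG E (x : ext_space E) : XG_set alpha G (orbit_map E x).
Proof. by move=> s h; rewrite /orbit_map ext_equivariant actionM. Qed.

Definition to_XG E (x : ext_space E) : XG alpha G :=
  SigSub (mem_set (orbit_map_XG E x)).

(** Both topologies on the target are initial, so continuity is tested coordinatewise; coordinate
    [h] is tau composed with the action of [h]. *)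
Lemma to_XG_continuous E : continuous (to_XG E).
Proof.
apply: (@continuous_comp_initial _ (ext_space E) _ (@set_val _ (XG_set alpha G))).
move=> x; apply/cvg_sup.
(* A neighbourhood for coordinate [h] contains the preimage under evaluation at [h] of some open [W]
   in [X]. *)
move=> h U [_ [[W oW <-] /= Wx]] /filterS; apply.
have /(_ W) : {for x, continuous (ext_map (e := E) \o ext_action E h)}.
  by apply: continuous_comp; [exact: action_continuous|exact: ext_continuous].
by apply; exact: open_nbhs_nbhs.
Qed.

Lemma to_XG_shift E g (x : ext_space E) :
  to_XG E (ext_action E g x) = XG_shift alpha G g (to_XG E x).
Proof.
by apply/val_inj/funext => h; rewrite /= /orbit_map /shift actionM.
Qed.

Lemma XG_proj_to_XG E : XG_proj alpha G \o to_XG E = ext_map (e := E).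
Proof. by apply/funext => x; rewrite /XG_proj /= /orbit_map action1. Qed.

Lemma extension_proj_surj E :
  set_surj [set: XG alpha G] [set: X] (XG_proj alpha G).
Proof.
move=> y /(@ext_surj _ _ _ _ E)[x _ <-].
by exists (to_XG E x) => //; rewrite -(XG_proj_to_XG E).
Qed.

Lemma XG_extension_natural
    (pi_surj : set_surj [set: XG alpha G] [set: X] (XG_proj alpha G)) :
  natural (XG_extension pi_surj).
Proof.
move=> E; exists (to_XG E); split.
  split; [exact: to_XG_continuous|exact: to_XG_shift|exact: XG_proj_to_XG].
move=> phi [_ phi_shift phi_proj].
apply/funext => x; apply/val_inj/funext => h.
(* Shifting by [h] brings coordinate [h] to the identity, where pi reads it: [tau (h . x) = pi (phi
   (h . x)) = pi (h . phi x) = (phi x)_h]. *)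
rewrite /= /orbit_map -phi_proj /= phi_shift /XG_proj /= /shift.
by rewrite mul1g.
Qed.

Lemma ext_morphism_id E : ext_morphism (E' := E) (E := E) id.
Proof. by split=> // x; exact: cvg_id. Qed.

Lemma ext_morphism_comp E1 E2 E3 (phi : ext_space E1 -> ext_space E2)
    (psi : ext_space E2 -> ext_space E3) :
  ext_morphism phi -> ext_morphism psi -> ext_morphism (psi \o phi).
Proof.
move=> [phi_cont phi_act phi_map] [psi_cont psi_act psi_map]; split.
- by move=> x; apply: continuous_comp; [exact: phi_cont|exact: psi_cont].
- by move=> g x; rewrite /= phi_act psi_act.
- by rewrite compA psi_map phi_map.
Qed.

(** Both [phi] and [id] are morphisms from [E] to itself, and naturality tested on [E] allows only
    one. *)
Lemma natural_endo_id E (phi : ext_space E -> ext_space E) :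
  natural E -> ext_morphism phi -> phi = id.
Proof.
move=> /(_ E)[psi [_ psi_uniq]] phi_morph.
by rewrite -(psi_uniq _ phi_morph); exact: psi_uniq (ext_morphism_id E).
Qed.

(** Uniqueness of terminal objects: the two composites of the comparison morphisms are
    endomorphisms, hence identities. *)
Lemma natural_isomorphic E1 E2 :
  natural E1 -> natural E2 -> ext_isomorphic E1 E2.
Proof.
move=> nat1 nat2.
have [phi [phi_morph _]] := nat2 E1; have [psi [psi_morph _]] := nat1 E2.
exists phi, psi; split=> // x.
- have := natural_endo_id _ _ nat1 (ext_morphism_comp _ _ _ _ _ phi_morph psi_morph).
  by move/(congr1 (@^~ x)).
- have := natural_endo_id _ _ nat2 (ext_morphism_comp _ _ _ _ _ psi_morph phi_morph).
  by move/(congr1 (@^~ x)).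
Qed.

End NaturalExtension.

Theorem proposition2p4
    (S : monoidType) (S_countable : countable [set: S])
    (S_embeddable : embeddable S)
    (X : topologicalType) (alpha : continuous_action S X)
    (G : receiving_group S) :
  let proj_surjective :=
    set_surj [set: XG alpha G] [set: X] (XG_proj alpha G) in
  let i := proj_surjective /\ ([set: X] !=set0 -> XG_set alpha G !=set0) in
  let ii := exists E : extension alpha G, natural E in
  let iii := inhabited (extension alpha G) in
  [/\ i <-> ii,
      ii <-> iii &
      forall (proj_surj : proj_surjective) (E : extension alpha G),
        natural E -> ext_isomorphic E (XG_extension proj_surj)].
Proof.
move=> pi_surj i ii iii.
have i_ii : i -> ii.
  by move=> [surj _]; exists (XG_extension surj); exact: XG_extension_natural.
have ii_iii : ii -> iii by move=> [E _]; exists.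
have iii_i : iii -> i.
  move=> [E]; have surj := extension_proj_surj _ _ _ _ E; split=> // -[y Xy].
  (* A preimage of [y] under pi is the required family. A point of [X] has to be given: for empty
     [X], pi is surjective while X_G is empty. *)
  by have [x _ _] := surj y Xy; exists (\val x); exact: set_valP.
split.
- by split=> // /ii_iii.
- by split=> // /iii_i.
- move=> surj E natE; apply: natural_isomorphic => //.
  exact: XG_extension_natural.
Qed.
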